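(* Let $0<q<1$, let $\{\omega_n(z;q)\}_{n\in\mathbb N_0}$ be an even $q$-Lidstone polynomial sequence of type I with associated numerical sequence $(\gamma_{2n})_{n\ge0}$, let $(\xi_{2n})_{n\ge0}$ be the sequence determined by $(\gamma_{2n})_n$ as in the context, and let $\{\hat\omega_n(z;q)\}_n$ be the conjugate sequence. Then $\omega_0(z;q)=\frac1{\xi_0}$ and, for $n\ge1$, $$\omega_{n}(z;q)= \frac{(-1)^n}{\xi_0^{n+1}}\det\begin{bmatrix} 1 & z^2 & z^4 & \cdots & z^{2n-2} & z^{2n} \\ \xi_0 & \xi_2 & \xi_4 & \cdots & \xi_{2(n-1)} & \xi_{2n} \\ 0 & \xi_0 & {4 \brack 2}_q\xi_2 & \cdots & {2n-2 \brack 2}_q\xi_{2(n-2)}& {2n \brack 2}_q\xi_{2(n-1)} \\ \vdots & & \ddots & & \vdots & \vdots \\ 0 & \cdots & \cdots & 0& \xi_0 & {2n \brack 2(n-1)}_q\xi_2\end{bmatrix}.$$ Explicitly, the matrix is $(n+1)\times(n+1)$ with columns indexed by $i=0,\dots,n$; its first row has entries $z^{2i}$, and for $k=0,\dots,n-1$ its $(k+2)$-nd row has entries ${2i \brack 2k}_q\xi_{2(i-k)}$ for $i\ge k$ and $0$ for $i<k$. Moreover, $\hat\omega_n(z;q)$ is given by the same formulas with $\gamma_{2k}$ in place of $\xi_{2k}$ for all $k=0,\dots,n$, for every $n\in\mathbb N_0$.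
   Context: Fix $0<q<1$. Put $[m]_q=\frac{1-q^m}{1-q}$, $[m]_q!=\prod_{j=1}^m[j]_q$, $[0]_q!=1$, and ${n \brack k}_q=\frac{[n]_q!}{[k]_q!\,[n-k]_q!}$ for $0\le k\le n$. $\mathbb N=\{1,2,\dots\}$, $\mathbb N_0=\mathbb N\cup\{0\}$. The Jackson $q$-derivative is $D_qf(z)=\frac{f(qz)-f(z)}{(q-1)z}$ for $z\ne0$ and $D_qf(0)=f'(0)$, so $D_qz^m=[m]_qz^{m-1}$. An even $q$-Lidstone polynomial sequence of type I (class $q$ELS-I) is a sequence $\{\omega_n(z;q)\}_{n\in\mathbb N_0}$ of polynomials in $z$ with real coefficients such that $D_q^2\omega_n(z;q)=[2n]_q[2n-1]_q\,\omega_{n-1}(z;q)$ for $n\in\mathbb N$, $D_q\omega_n(0;q)=0$ for $n\in\mathbb N_0$, and $\omega_0(z;q)=\gamma_0$ with $\gamma_0\in\mathbb R\setminus\{0\}$. Its associated numerical sequence is $\gamma_{2n}:=\omega_n(0;q)$, and $\omega_n(z;q)=\sum_{k=0}^n{2n \brack 2k}_q\gamma_{2(n-k)}z^{2k}$. The sequence $(\xi_{2n})_{n\ge0}$ is the unique real sequence with $\sum_{j=0}^n\frac{\gamma_{2j}\,\xi_{2(n-j)}}{[2j]_q!\,[2(n-j)]_q!}=\delta_{n0}$ for all $n\in\mathbb N_0$. The conjugate sequence of $\{\omega_n\}_n$ is $\hat\omega_n(z;q)=\sum_{k=0}^n{2n \brack 2k}_q\xi_{2(n-k)}z^{2k}$.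 *)

(* Defs.v *)
From HB Require Import structures.
From mathcomp Require Import all_boot all_order all_algebra.
From mathcomp Require Import all_classical all_reals all_analysis.

Set Implicit Arguments.
Unset Strict Implicit.
Unset Printing Implicit Defensive.

Import Order.TTheory GRing.Theory Num.Theory.
Import numFieldNormedType.Exports.

Local Open Scope ring_scope.

Definition qnum (R : realType) (q : R) (m : nat) : R := (1 - q ^+ m) / (1 - q).

Definition qfact (R : realType) (q : R) (m : nat) : R :=
  \prod_(1 <= j < m.+1) qnum q j.

(* Meaningful for [k <= n] only: [n - k] is truncated subtraction. *)
Definition qbinom (R : realType) (q : R) (n k : nat) : R :=
  qfact q n / (qfact q k * qfact q (n - k)).

(* [derive1] is the analytic derivative, so [jackson q f 0] is f'(0). *)
Definition jackson (R : realType) (q : R) (f : R -> R) (z : R) : R :=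
  if z == 0 then derive1 f 0 else (f (q * z) - f z) / ((q - 1) * z).

Definition qELS_I (R : realType) (q : R) (omega : nat -> {poly R}) : Prop :=
  [/\ forall n : nat, (1 <= n)%N -> forall z : R,
        jackson q (jackson q (horner (omega n))) z =
        qnum q (2 * n) * qnum q (2 * n - 1) * (omega (n - 1)%N).[z],
      forall n : nat, jackson q (horner (omega n)) 0 = 0 &
      exists2 gamma0 : R, gamma0 != 0 & omega 0%N = gamma0%:P].

(* Sequences carrying even indices are stored by half-index: [numseq omega n]
   is gamma_{2n}, and below [xi n] is xi_{2n}. *)
Definition numseq (R : realType) (omega : nat -> {poly R}) (n : nat) : R :=
  (omega n).[0].

Definition reciprocal_seq (R : realType) (q : R) (gamma xi : nat -> R) : Prop :=
  forall n : nat,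
    \sum_(j < n.+1)
      gamma j * xi (n - j)%N / (qfact q (2 * j) * qfact q (2 * (n - j)))
    = (n == 0%N)%:R.

Definition conjugate_seq (R : realType) (q : R) (xi : nat -> R) (n : nat)
    : {poly R} :=
  \sum_(k < n.+1) (qbinom q (2 * n) (2 * k) * xi (n - k)%N) *: 'X^(2 * k).

(* Row [r = k + 1] has, in column [i], the entry {2i brack 2k}_q a_{2(i-k)} when
   [k <= i], and 0 otherwise. *)
Definition lidstone_mx (R : realType) (q : R) (a : nat -> R) (n : nat)
    : 'M[{poly R}]_n.+1 :=
  \matrix_(r < n.+1, i < n.+1)
    match nat_of_ord r with
    | 0%N => 'X^(2 * i)
    | k.+1 =>
        if (k <= i)%N then (qbinom q (2 * i) (2 * k) * a (i - k)%N)%:P else 0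
    end.

(* Main.v *)
Require Import Defs.
From HB Require Import structures.
From mathcomp Require Import all_boot all_order all_algebra.
From mathcomp Require Import all_classical all_reals all_analysis.
From mathcomp Require Import ring.

Set Implicit Arguments.
Unset Strict Implicit.
Unset Printing Implicit Defensive.

Import Order.TTheory GRing.Theory Num.Theory.
Import numFieldNormedType.Exports.

Local Open Scope ring_scope.

(** q-differentiating turns the functional equations of the class into
    coefficient recurrences, whose solution is
    [omega n = conjugate_seq q (numseq omega) n]. The matrices
    ({2i brack 2j}_q a_{2(i-j)}) and ({2i brack 2j}_q b_{2(i-j)}) are inverse to
    each other when [a] and [b] are reciprocal, so multiplying the determinantal
    matrix of [a] by the triangular matrix of [b] leaves the conjugate
    polynomials of [b] in the first row above shifted unit rows; comparing
    determinants gives both formulas, as reciprocity is symmetric. *)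

(** The difference of the two polynomials vanishes at 0, 1, 2, ..., which are distinct in
    characteristic zero, and more of them are taken than its degree allows. *)
Lemma horner_inj (R : numDomainType) : injective (@horner R : {poly R} -> R -> R).
Proof.
move=> p r pr; apply/eqP; rewrite -subr_eq0.
set d := p - r.
pose s : seq R := [seq i%:R | i <- iota 0 (size d)].
apply/eqP; apply: (@roots_geq_poly_eq0 _ d s); last by rewrite size_map size_iota.
- by apply/allP => x _; rewrite rootE /d hornerD hornerN pr subrr.
- rewrite map_inj_uniq ?iota_uniq // => i j /eqP.
  by rewrite eqr_nat => /eqP.
Qed.

Lemma qfact0 (R : realType) (q : R) : qfact q 0 = 1.
Proof. by rewrite /qfact big_geq. Qed.

Lemma qfactS (R : realType) (q : R) n : qfact q n.+1 = qfact q n * qnum q n.+1.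
Proof. by rewrite /qfact big_nat_recr. Qed.

(** Coefficientwise form of the Jackson derivative, which can be iterated without leaving the
    polynomials. *)
Definition qderiv (R : realType) (q : R) (p : {poly R}) : {poly R} :=
  \poly_(i < (size p).-1) (qnum q i.+1 * p`_i.+1).

Section QCalculus.
Variables (R : realType) (q : R).
Hypotheses (hq0 : 0 < q) (hq1 : q < 1).

Lemma qnum_neq0 m : qnum q m.+1 != 0.
Proof.
by rewrite mulf_neq0 ?invr_neq0 // subr_eq0 eq_sym lt_eqF // exprn_ilt1 // ltW.
Qed.

Lemma qfact_neq0 m : qfact q m != 0.
Proof.
elim: m => [|m IH]; first by rewrite qfact0 oner_eq0.
by rewrite qfactS mulf_neq0 ?qnum_neq0.
Qed.

Lemma coef_qderiv (p : {poly R}) i : (qderiv q p)`_i = qnum q i.+1 * p`_i.+1.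
Proof.
rewrite coef_poly; case: ltnP => // h.
by rewrite [p`__]nth_default ?mulr0 // -ltnS; case: (size p) h.
Qed.

Lemma jackson_horner (p : {poly R}) :
  jackson q (horner p) = horner (qderiv q p).
Proof.
apply/funext => z; rewrite /jackson.
have q1 : 1 - q != 0 by rewrite subr_eq0 eq_sym lt_eqF.
case: eqP => [->|/eqP z0].
  (* At 0 the ordinary derivative is the coefficient of ['X], which agrees because [qnum q 1] is
     1. *)
  rewrite -derivE !horner_coef0 coef_qderiv coef_deriv /qnum expr1 divff //.
  by rewrite mul1r mulr1n.
have q1' : q - 1 != 0 by rewrite subr_eq0 lt_eqF.
apply: (@mulIf _ ((q - 1) * z)); first by rewrite mulf_neq0.
rewrite divfK ?mulf_neq0 // /qderiv horner_poly !horner_coef.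
case: (size p) => [|m]; first by rewrite !big_ord0 subrr mul0r.
rewrite !big_ord_recl /= !expr0 !mulr1 opprD addrACA subrr add0r mulr_suml.
rewrite -sumrB; apply: eq_bigr => i _.
by rewrite /qnum /bump /= add1n exprMn ![_ ^+ i.+1]exprSr; field.
Qed.

Lemma coef_conjugate_seq (a : nat -> R) n i :
  (conjugate_seq q a n)`_i =
  if ~~ odd i && (i./2 <= n)%N then qbinom q (2 * n) i * a (n - i./2)%N else 0.
Proof.
rewrite /conjugate_seq coef_sum.
under eq_bigr => k _ do rewrite coefZ coefXn.
case: ifP => [/andP[io il]|h].
  have i2 : i = (2 * i./2)%N by rewrite mul2n even_halfK.
  rewrite (bigD1 (Ordinal (il : (i./2 < n.+1)%N))) //= -i2 eqxx mulr1.
  rewrite big1 ?addr0 // => k /eqP kn; case: eqP => [e|_]; last by rewrite mulr0.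
  by case: kn; apply: val_inj; rewrite /= e mul2n doubleK.
rewrite big1 // => k _; case: eqP => [e|_]; last by rewrite mulr0.
by move: h; rewrite e mul2n odd_double doubleK -ltnS ltn_ord.
Qed.

Lemma qbinomn0 n : qbinom q n 0 = 1.
Proof. by rewrite /qbinom subn0 qfact0 mul1r divff ?qfact_neq0. Qed.

Lemma qbinomnn n : qbinom q n n = 1.
Proof. by rewrite /qbinom subnn qfact0 mulr1 divff ?qfact_neq0. Qed.

Lemma qbinomSS n k :
  qbinom q n.+1 k.+1 = qnum q n.+1 * qbinom q n k / qnum q k.+1.
Proof. by rewrite /qbinom !qfactS subSS; field; rewrite !qfact_neq0 qnum_neq0. Qed.

Lemma qELS_IE omega : qELS_I q omega ->
  omega = conjugate_seq q (numseq omega).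
Proof.
case=> hD h0 [g g0 o0]; apply/funext => n; rewrite /conjugate_seq.
(* The recurrence [h2] below lowers the index by two, so this coefficient governs all odd ones and
   [h0'] all even ones. *)
have h1 m : (omega m)`_1 = 0.
  have := h0 m; rewrite jackson_horner horner_coef0 coef_qderiv => /eqP.
  by rewrite mulf_eq0 (negPf (qnum_neq0 _)) => /eqP.
have h2 m i : (omega m.+1)`_i.+2 = qnum q (2 * m).+2 * qnum q (2 * m).+1
    * (omega m)`_i / (qnum q i.+2 * qnum q i.+1).
  have : qderiv q (qderiv q (omega m.+1)) =
      (qnum q (2 * m).+2 * qnum q (2 * m).+1) *: omega m.
    apply/horner_inj/funext => z; rewrite -!jackson_horner hD // hornerZ.
    by rewrite mulnS !subn1.
  move/(congr1 (fun p : {poly R} => p`_i)); rewrite !coef_qderiv coefZ => <-.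
  by field; rewrite !qnum_neq0.
have h0' m : (omega m)`_0 = numseq omega m by rewrite -horner_coef0.
apply/polyP => i; rewrite coef_conjugate_seq.
elim: n i => [|n IH] [|[|i]]; rewrite ?h0' ?h1 ?qbinomn0 ?mul1r ?subn0 //=.
  by rewrite o0 coefC andbF.
rewrite h2 IH negbK ltnS mulnS subSS; case: ifP => _; last by rewrite mulr0 mul0r.
by rewrite !qbinomSS; field; rewrite !qnum_neq0.
Qed.

Lemma qbinom_convolution (a b : nat -> R) k i : reciprocal_seq q a b ->
  (k <= i)%N ->
  \sum_(k <= j < i.+1) (qbinom q (2 * j) (2 * k) * a (j - k)%N *
     (qbinom q (2 * i) (2 * j) * b (i - j)%N)) = (k == i)%:R.
Proof.
move=> ab ki; rewrite -{1}(add0n k) big_addn subSn // big_mkord.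
(* The factors [qfact q (2 * j)] cancel, leaving a constant times the reciprocity sum of order
   [i - k]. *)
transitivity (qfact q (2 * i) / qfact q (2 * k) * (i - k == 0)%N%:R).
  rewrite -(ab (i - k)%N) mulr_sumr; apply: eq_bigr => j _.
  have ji : (j <= i - k)%N by rewrite -ltnS.
  rewrite /qbinom -!mulnBr addnK [(j + k)%N]addnC subnDA.
  by field; rewrite !qfact_neq0.
rewrite subn_eq0; case: (ltngtP k i) ki => // [_|->] _; first by rewrite mulr0.
by rewrite mulr1 divff ?qfact_neq0.
Qed.

Lemma det_lidstone_mx (a b : nat -> R) n : reciprocal_seq q a b ->
  conjugate_seq q b n = ((-1) ^+ n / a 0%N ^+ n.+1) *: \det (lidstone_mx q a n).
Proof.
move=> ab.
have ab0 : a 0%N * b 0%N = 1.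
  by have := ab 0%N; rewrite big_ord1 /= !qfact0 mulr1 divr1.
have a0 : a 0%N != 0.
  by apply: contra_eq_neq ab0 => ->; rewrite mul0r eq_sym oner_eq0.
(* Row [i] of [U] lists the coefficients of [conjugate_seq q b i] in powers of ['X^2]; hence the
   transpose in [MU]. *)
pose U : 'M[{poly R}]_n.+1 := \matrix_(i, j)
  if (j <= i)%N then (qbinom q (2 * i) (2 * j) * b (i - j)%N)%:P else 0.
have dU : \det U = (b 0%N ^+ n.+1)%:P.
  rewrite det_trig.
    under eq_bigr => i _ do rewrite mxE leqnn qbinomnn subnn mul1r.
    by rewrite prodr_const card_ord -rmorphXn.
  by apply/is_trig_mxP => i j ij; rewrite mxE leqNgt ij.
have MU : lidstone_mx q a n *m U^T = \matrix_(r, i)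
    if nat_of_ord r is k.+1 then (k == i)%:R else conjugate_seq q b i.
  apply/matrixP => r i; rewrite !mxE.
  under eq_bigr => j _ do rewrite !mxE.
  case: (nat_of_ord r) => [|k].
    rewrite /conjugate_seq (big_ord_widen_cond n.+1 xpredT
      (fun k => (qbinom q (2 * i) (2 * k) * b (i - k)%N) *: 'X^(2 * k))) //.
    rewrite [RHS]big_mkcond; apply: eq_bigr => j _ /=; rewrite ltnS.
    by case: ifP => _; rewrite ?mulr0 // mulrC mul_polyC.
  case: (leqP k i) => [ki|ik].
    (* The convolution over [k <= j <= i] is extended to all columns; outside this range one of the
       two triangular factors is zero. *)
    rewrite -[RHS]/((_)%:R) -(rmorph_nat polyC) -(qbinom_convolution ab ki).
    rewrite rmorph_sum /= (big_nat_widenl _ 0%N) //.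
    rewrite (big_nat_widen _ _ n.+1) ?ltn_ord //.
    rewrite big_mkord [RHS]big_mkcond; apply: eq_bigr => j _ /=.
    rewrite ltnS; case: leqP => _; case: leqP => _ /=;
      by rewrite ?mulr0 ?mul0r -?polyCM.
  rewrite big1 ?gtn_eqF // => j _.
  case: leqP => kj; last by rewrite mul0r.
  by rewrite leqNgt (leq_trans ik kj) mulr0.
have : \det (lidstone_mx q a n) * \det U = (-1) ^+ n * conjugate_seq q b n.
  (* In the last column the shifted unit rows vanish, as [k < n]. Only the top entry survives; its
     minor is the identity and its sign is [(-1) ^+ n]. *)
  rewrite -[\det U]det_tr -det_mulmx MU (expand_det_col _ ord_max).
  rewrite big_ord_recl big1 => [|i _]; last first.
    by rewrite mxE /= ltn_eqF ?mul0r ?ltn_ord.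
  rewrite mxE addr0 /cofactor add0n mulrC /=.
  rewrite -mulrA; congr (_ * _).
  rewrite (_ : row' _ _ = 1%:M) ?det1 ?mul1r //.
  by apply/matrixP => i j; rewrite !mxE /= /bump leqNgt ltn_ord.
rewrite dU mulrC mul_polyC -[_ ^+ n in RHS]signr_odd mulr_sign -scaler_sign.
rewrite signr_odd => e; have ba : (a 0%N)^-1 = b 0%N.
  by apply: (mulfI a0); rewrite ab0 divff.
(* With [b 0] for the inverse of [a 0], the prefactor becomes [(-1) ^+ n] times [\det U], and the
   two signs cancel. *)
by rewrite -exprVn ba -scalerA e scalerA -exprMn mulrNN mulr1 expr1n scale1r.
Qed.

Lemma reciprocal_seqC (a b : nat -> R) :
  reciprocal_seq q a b -> reciprocal_seq q b a.
Proof.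
move=> ab n; rewrite -(ab n) (reindex_inj rev_ord_inj) /=.
apply: eq_bigr => j _; have jn : (j <= n)%N by rewrite -ltnS.
rewrite subSS subKn //.
by rewrite [b _ * _]mulrC [qfact _ _ * _]mulrC.
Qed.
End QCalculus.

Theorem theorem3p13 (R : realType) (q : R) (hq0 : 0 < q) (hq1 : q < 1)
    (omega : nat -> {poly R}) (homega : qELS_I q omega)
    (xi : nat -> R) (hxi : reciprocal_seq q (numseq omega) xi) :
  [/\ omega 0%N = ((xi 0%N)^-1)%:P,
      forall n : nat, (1 <= n)%N ->
        omega n =
        ((-1) ^+ n / xi 0%N ^+ n.+1) *: \det (lidstone_mx q xi n),
      conjugate_seq q xi 0 = ((numseq omega 0)^-1)%:P &
      forall n : nat, (1 <= n)%N ->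
        conjugate_seq q xi n =
        ((-1) ^+ n / numseq omega 0 ^+ n.+1) *:
          \det (lidstone_mx q (numseq omega) n)].
Proof.
have omegaE := qELS_IE hq0 hq1 homega.
(* The formula for [omega] takes [xi] as matrix entries and [numseq omega] as conjugate
   coefficients, so it uses reciprocity in swapped order. *)
have hxi' := reciprocal_seqC hxi.
(* For [n = 0] only the entry ['X^0] remains, so the determinantal formula reduces to the stated
   constants. *)
have det0 a : \det (lidstone_mx q a 0) = 1.
  by rewrite det_mx11 mxE muln0 expr0.
split=> [|n _||n _].
- rewrite omegaE (det_lidstone_mx hq0 hq1 _ hxi') det0.
  by rewrite expr0 expr1 mul1r alg_polyC.
- by rewrite {1}omegaE; apply: det_lidstone_mx.
- by rewrite (det_lidstone_mx hq0 hq1 _ hxi) det0 expr0 expr1 mul1r alg_polyC.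
- exact: det_lidstone_mx.
Qed.
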